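(* Let $1<p<2$, $q=p/(p-1)$, $\sigma=p-1$, $\varepsilon>0$. Suppose the pair $(f(x_0),\nabla f(x_0))$ is already cached, put $G=\|\nabla f(x_0)\|_q>\varepsilon$, and let $M,D>0$ satisfy $D\ge G/M$. There is an explicit deterministic finite routine using only $p,\varepsilon,x_0,M,D$, cached oracle data, and new exact value-gradient pair queries (in particular not using $L$, $R$ or $\min f$), which has exactly the following outcomes: (i) $\mathsf{Success}$, with a queried point $\widehat x$ satisfying $\|\nabla f(\widehat x)\|_q\le\varepsilon$; (ii) $\mathsf{Scale}$, accompanied by an actually failed predicate $\mathsf C_M(X,Y)$ at a pair of consecutively queried points, and necessarily $M<L$; (iii) $\mathsf{Radius}$, possible only after all tested predicates pass and the terminal queried pair has gradient norm larger than $\varepsilon$, and necessarily $D<R$. Its number of new pair queries satisfies $$N_{\rm local}\le4\sqrt{\frac{MD}{\sigma\varepsilon}}+2\le\left(\frac{4}{\sqrt\sigma}+2\right)\sqrt{\frac{MD}{\varepsilon}}.$$ Thus the cost is $O_p(\sqrt{MD/\varepsilon})$, with no dimension-dependent constant.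
   Context: $f:\mathbb R^d\to\mathbb R$ is differentiable and convex, $X^*:=\operatorname{argmin}f\ne\varnothing$, $\|\nabla f(x)-\nabla f(y)\|_q\le L\|x-y\|_p$ for all $x,y\in\mathbb R^d$, and $R:=\operatorname{dist}_p(x_0,X^* )$. A pair query at $x$ returns exactly $(f(x),\nabla f(x))$. The predicate $\mathsf C_M(X,Y)$ is $$f(X)-f(Y)-\langle\nabla f(Y),X-Y\rangle\ \ge\ \frac{\|\nabla f(X)-\nabla f(Y)\|_q^2}{2M}.$$ The routine tests this predicate only at pairs of consecutive queried points $(X,Y)$ ($Y$ queried directly after $X$ along the trajectory, both pairs cached). *)

(* Defs.v *)
From HB Require Import structures.
From mathcomp Require Export all_boot all_order all_algebra.
From mathcomp Require Export all_classical all_reals all_analysis.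
Export numFieldNormedType.Exports.
Import Order.TTheory GRing.Theory Num.Theory.

Set Implicit Arguments.
Unset Strict Implicit.
Unset Printing Implicit Defensive.

#[export] Set Implicit Arguments.
#[export] Unset Strict Implicit.
#[export] Unset Printing Implicit Defensive.

Local Open Scope classical_set_scope.
Local Open Scope ring_scope.

(* The library norm `|x| on 'rV[R]_d is the sup norm.  It is used only through
   differentiability, which in finite dimension does not depend on the norm. *)
Definition lp_norm (R : realType) (d : nat) (p : R) (x : 'rV[R]_d) : R :=
  (\sum_(i < d) `|x 0 i| `^ p) `^ p^-1.

Definition dotprod (R : realType) (d : nat) (x y : 'rV[R]_d) : R :=
  \sum_(i < d) x 0 i * y 0 i.

Definition grad (R : realType) (d : nat) (f : 'rV[R]_d -> R) (x : 'rV[R]_d) :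
    'rV[R]_d :=
  \row_(i < d) 'D_(delta_mx 0 i) f x.

Definition argmin (R : realType) (d : nat) (f : 'rV[R]_d -> R) :
    set 'rV[R]_d :=
  [set x | forall y, f x <= f y].

Definition lp_dist (R : realType) (d : nat) (p : R) (x : 'rV[R]_d)
    (A : set 'rV[R]_d) : R :=
  inf [set lp_norm p (x - y) | y in A].

(* The predicate C_M(X, Y). *)
Definition cocoercive_at (R : realType) (d : nat) (q M : R)
    (f : 'rV[R]_d -> R) (X Y : 'rV[R]_d) : bool :=
  f X - f Y - dotprod (grad f Y) (X - Y)
    >= lp_norm q (grad f X - grad f Y) ^+ 2 / (2 * M).

Inductive outcome (R : realType) (d : nat) : Type :=
| Success of 'rV[R]_d
| Scale of 'rV[R]_d & 'rV[R]_d
| Radius.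
Arguments Radius {R d}.

(* A deterministic adaptive routine is a well-founded decision tree, so all its
   runs are finite.  [Query x k] asks for a value-gradient pair at [x] and
   continues with the answer; [Test X Y k] evaluates C_M(X, Y) and continues
   with the truth value. *)
Inductive routine (R : realType) (d : nat) : Type :=
| Return of outcome R d
| Query of 'rV[R]_d & (R -> 'rV[R]_d -> routine R d)
| Test of 'rV[R]_d & 'rV[R]_d & (bool -> routine R d).

Fixpoint run_outcome (R : realType) (d : nat) (q M : R) (f : 'rV[R]_d -> R)
    (r : routine R d) : outcome R d :=
  match r with
  | Return o => o
  | Query x k => run_outcome q M f (k (f x) (grad f x))
  | Test X Y k => run_outcome q M f (k (cocoercive_at q M f X Y))
  end.

(* The new queries, in chronological order; repetitions are counted. *)
Fixpoint run_queries (R : realType) (d : nat) (q M : R) (f : 'rV[R]_d -> R)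
    (r : routine R d) : seq 'rV[R]_d :=
  match r with
  | Return _ => [::]
  | Query x k => x :: run_queries q M f (k (f x) (grad f x))
  | Test X Y k => run_queries q M f (k (cocoercive_at q M f X Y))
  end.

Fixpoint run_tests (R : realType) (d : nat) (q M : R) (f : 'rV[R]_d -> R)
    (r : routine R d) : seq ('rV[R]_d * 'rV[R]_d) :=
  match r with
  | Return _ => [::]
  | Query x k => run_tests q M f (k (f x) (grad f x))
  | Test X Y k => (X, Y) :: run_tests q M f (k (cocoercive_at q M f X Y))
  end.

(* Every test of the run concerns two points that are consecutive in the
   trajectory at the moment of the test, so that both pairs are then cached;
   [s] is the trajectory cached before [r] starts. *)
Fixpoint tests_consecutive (R : realType) (d : nat) (q M : R)
    (f : 'rV[R]_d -> R) (r : routine R d) (s : seq 'rV[R]_d) : bool :=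
  match r with
  | Return _ => true
  | Query x k => tests_consecutive q M f (k (f x) (grad f x)) (rcons s x)
  | Test X Y k => infix [:: X; Y] s
      && tests_consecutive q M f (k (cocoercive_at q M f X Y)) s
  end.

(* Main.v *)
Require Import Defs.
From mathcomp Require Import ring lra.
Import Order.TTheory GRing.Theory Num.Theory.

Local Open Scope classical_set_scope.
Local Open Scope ring_scope.

(** The routine is an accelerated method in two phases of equal length n, in the
    geometry of the p-norm.

    For 1 < p < 2 the conjugate exponent satisfies q > 2, and half the squared q-norm
    is smooth with the dimension-free constant q - 1 = 1 / sigma
    ([lp_norm_sqr_smooth]). Its gradient [dual_map] plays the role of the mirror map.

    The first phase decreases f. It is dual averaging in which the coming gradient is
    predicted by the current one. The prediction error is a multiple of the difference
    of two consecutive gradients, and the squared error is exactly what the inequality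
    C_M at this consecutive pair pays for. The other ingredient is the tangent
    inequality of a convex function, which needs no constant. So, if all tests pass,
    every minimizer z satisfies
      f x_n - f z <= (M / sigma) |x0 - z|_p ^ 2 / (2 beta_n ^ 2)
    ([extrapolation_phase]).

    The second phase turns this gap into a small gradient. It is the first phase run
    backwards: the dual variable is a running average of the gradients that ends at the
    last one, and again the tests pay for the prediction errors. It gives
      |g_n|_q ^ 2 / 2 <= M / (sigma e_n ^ 2) * (f x_n - min f)
    for the last gradient g_n, where x_n is the point at which the second phase starts
    ([averaging_phase]).

    Together, e_n beta_n |g_n|_q <= (M / sigma) |x0 - z|_p ([lp_gradient_bound]). The
    optimal weights e_n and beta_n are n / 2 up to logarithmic corrections, which have
    opposite signs and cancel well enough in the product for e_n beta_n >= n ^ 2 / 4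
    ([sqr_le_coef_product]). With K = sqrt (M D / (sigma eps)) and n = floor (2 K) + 1
    the product exceeds K ^ 2. A last gradient larger than eps then forces
    D < |x0 - z|_p, uniformly in z, which is the outcome Radius; and the number of
    queries is at most 2 n <= 4 K + 2. The hypothesis G / M <= D with eps < G makes
    M D / eps larger than 1, so that the additive 2 is absorbed.

    A failed test is the outcome Scale. It forces M < L because a convex function whose
    gradient is L-Lipschitz satisfies C_M for all M >= L
    ([smooth_convex_cocoercive]). *)

(** * Norms, pairing and mirror map *)

Section FiniteHoelder.
Context {R : realType} {d : nat}.
Implicit Types (p q : R) (x y u v : 'rV[R]_d).

(** Young's inequality, applied to each term after both factors have been scaled
    to norm one. *)
Lemma sum_hoelder p q (a b : 'I_d -> R) : 0 < p -> 0 < q -> p^-1 + q^-1 = 1 ->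
  (forall i, 0 <= a i) -> (forall i, 0 <= b i) ->
  \sum_i a i * b i <=
    (\sum_i a i `^ p) `^ p^-1 * (\sum_i b i `^ q) `^ q^-1.
Proof.
move=> p0 q0 pq a0 b0.
set A := \sum_i a i `^ p; set B := \sum_i b i `^ q.
have A0 : 0 <= A by apply: sumr_ge0 => i _; exact: powR_ge0.
have B0 : 0 <= B by apply: sumr_ge0 => i _; exact: powR_ge0.
have sum_eq0 (c : 'I_d -> R) r : 0 < r ->
    \sum_i c i `^ r = 0 -> forall i, c i = 0.
  move=> r0 /psumr_eq0P c0 i; apply: (@powR_eq0_eq0 _ _ r).
  by apply: c0 => // j _; exact: powR_ge0.
have [/eqP Az|An] := eqVneq A 0.
  rewrite big1 ?mulr_ge0 ?powR_ge0// => i _.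
  by rewrite (sum_eq0 a p p0 (eqP Az)) mul0r.
have [/eqP Bz|Bn] := eqVneq B 0.
  rewrite big1 ?mulr_ge0 ?powR_ge0// => i _.
  by rewrite (sum_eq0 b q q0 (eqP Bz)) mulr0.
have Ap : 0 < A by rewrite lt_neqAle eq_sym An.
have Bp : 0 < B by rewrite lt_neqAle eq_sym Bn.
set s := A `^ p^-1; set t := B `^ q^-1.
have s0 : 0 < s by exact: powR_gt0.
have t0 : 0 < t by exact: powR_gt0.
have sp : s `^ p = A by rewrite /s -powRrM mulVf ?powRr1// gt_eqF.
have tq : t `^ q = B by rewrite /t -powRrM mulVf ?powRr1// gt_eqF.
clearbody s t.
have st0 : 0 < s * t by exact: mulr_gt0.
rewrite -[leRHS]mulr1 -ler_pdivrMl// mulr_sumr.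
have one : \sum_i (a i `^ p / A / p + b i `^ q / B / q) = 1 :> R.
  rewrite big_split/= -!mulr_suml.
  by rewrite -/A -/B !divff// !div1r pq.
rewrite -[leRHS]one {one}.
apply: ler_sum => i _.
have := @conjugate_powR _ (a i / s) (b i / t) p q.
rewrite !powRM ?invr_ge0 ?powR_ge0// ?a0 ?b0 ?(ltW s0) ?(ltW t0)//.
have invpow (z r : R) : 0 <= z -> z^-1 `^ r = (z `^ r)^-1.
  by move=> z0; rewrite -powR_inv1// -powRrM mulN1r powRN.
rewrite !invpow ?(ltW s0) ?(ltW t0)// sp tq.
move=> /(_ _ _ p0 q0 pq); rewrite !divr_ge0 ?(ltW s0) ?(ltW t0)//.
move=> /(_ isT isT); apply: le_trans.
by rewrite mulf_div mulrC.
Qed.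

Lemma dotprodC x y : dotprod x y = dotprod y x.
Proof. by apply: eq_bigr => i _; rewrite mulrC. Qed.

Lemma dotprodDl x y u : dotprod (x + y) u = dotprod x u + dotprod y u.
Proof. by rewrite -big_split; apply: eq_bigr => i _; rewrite mxE mulrDl. Qed.

Lemma dotprodZl (c : R) x y : dotprod (c *: x) y = c * dotprod x y.
Proof. by rewrite mulr_sumr; apply: eq_bigr => i _; rewrite mxE mulrA. Qed.

Lemma dotprodNl x y : dotprod (- x) y = - dotprod x y.
Proof. by rewrite -scaleN1r dotprodZl mulN1r. Qed.

Lemma dotprodDr x y u : dotprod u (x + y) = dotprod u x + dotprod u y.
Proof. by rewrite dotprodC dotprodDl !(dotprodC u). Qed.

Lemma dotprodZr (c : R) x y : dotprod x (c *: y) = c * dotprod x y.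
Proof. by rewrite dotprodC dotprodZl dotprodC. Qed.

Lemma dotprodNr x y : dotprod x (- y) = - dotprod x y.
Proof. by rewrite dotprodC dotprodNl dotprodC. Qed.

Lemma dotprod0l x : dotprod 0 x = 0.
Proof. by rewrite -(scale0r (0 : 'rV[R]_d)) dotprodZl mul0r. Qed.

Lemma dotprod0r x : dotprod x 0 = 0.
Proof. by rewrite dotprodC dotprod0l. Qed.

Definition dotprodE := (dotprodDl, dotprodDr, dotprodNl, dotprodNr,
  dotprodZl, dotprodZr, dotprod0l, dotprod0r).

Lemma lp_norm_ge0 q x : 0 <= lp_norm q x.
Proof. exact: powR_ge0. Qed.

Lemma lp_normX q x : 0 < q -> lp_norm q x `^ q = \sum_i `|x 0 i| `^ q.
Proof.
move=> q0; rewrite -powRrM mulVf ?gt_eqF// powRr1//.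
by apply: sumr_ge0 => i _; exact: powR_ge0.
Qed.

Lemma lp_normZ q (c : R) x : 0 < q -> lp_norm q (c *: x) = `|c| * lp_norm q x.
Proof.
move=> q0; rewrite /lp_norm.
under eq_bigr do rewrite mxE normrM powRM//.
rewrite -mulr_sumr powRM ?powR_ge0//; last first.
  by apply: sumr_ge0 => i _; exact: powR_ge0.
by rewrite -powRrM mulfV ?gt_eqF// powRr1.
Qed.

Lemma lp_norm0 q : 0 < q -> lp_norm q (0 : 'rV[R]_d) = 0.
Proof. by move=> q0; rewrite -(scale0r (0 : 'rV[R]_d)) lp_normZ// normr0 mul0r. Qed.

Lemma lp_norm_eq0 q x : 0 < q -> lp_norm q x = 0 -> x = 0.
Proof.
move=> q0 x0; have := lp_normX x q0; rewrite x0 powR0 ?gt_eqF// => /esym.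
move=> /psumr_eq0P E; apply/rowP => i; rewrite mxE.
apply/normr0_eq0/(@powR_eq0_eq0 _ _ q)/E => // j _; exact: powR_ge0.
Qed.

Lemma dotprod_le_lp_norm p q x y : 0 < p -> 0 < q -> p^-1 + q^-1 = 1 ->
  dotprod x y <= lp_norm p x * lp_norm q y.
Proof.
move=> p0 q0 pq; apply: le_trans (sum_hoelder p0 q0 pq _ _) => //.
apply: ler_sum => i _; rewrite -normrM; exact: ler_norm.
Qed.

End FiniteHoelder.

Section DualityMap.
Context {R : realType} {d : nat}.
Variables p q : R.
Hypotheses (p0 : 0 < p) (q2 : 2 < q) (pq : p^-1 + q^-1 = 1).
Implicit Types (x y u v : 'rV[R]_d).

Let q0 : 0 < q. Proof. by move: q2; lra. Qed.

(** The gradient of half the squared q-norm. *)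
Definition dual_map u : 'rV[R]_d :=
  \row_i (lp_norm q u `^ (2 - q) * (`|u 0 i| `^ (q - 2) * u 0 i)).

Lemma powR_normM r (a : R) : 0 < r -> `|a| `^ (r - 1) * `|a| = `|a| `^ r.
Proof. by move=> r0; rewrite mulrC mulr_powRB1. Qed.

Lemma dotprod_dual_map u : dotprod (dual_map u) u = lp_norm q u ^+ 2.
Proof.
have [->|u0] := eqVneq u 0.
  by rewrite dotprod0r lp_norm0// expr0n.
have n0 : 0 < lp_norm q u.
  rewrite lt_neqAle lp_norm_ge0 andbT eq_sym; apply: contra u0 => /eqP.
  by move=> /(lp_norm_eq0 q0) ->.
transitivity (lp_norm q u `^ (2 - q) * lp_norm q u `^ q).
  rewrite lp_normX// mulr_sumr; apply: eq_bigr => i _.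
  rewrite mxE -!mulrA -expr2 -[u 0 i ^+ 2]real_normK ?num_real//.
  congr (_ * _); rewrite -powR_mulrn// -powRD ?subrK//.
  by rewrite gt_eqF.
by rewrite -powRD ?(gt_eqF n0) ?implybT// subrK powR_mulrn// ltW.
Qed.

Lemma lp_norm_dual_map u : lp_norm p (dual_map u) = lp_norm q u.
Proof.
have [->|u0] := eqVneq u 0.
  rewrite [dual_map 0](_ : _ = 0) ?lp_norm0//.
  by apply/rowP => i; rewrite !mxE !mulr0.
have n0 : 0 < lp_norm q u.
  rewrite lt_neqAle lp_norm_ge0 andbT eq_sym; apply: contra u0 => /eqP.
  by move=> /(lp_norm_eq0 q0) ->.
have pqE : p + q = p * q.
  have : (p + q) / (p * q) = 1 by rewrite -pq; field; rewrite !gt_eqF.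
  by move=> /divr1_eq.
suff E : \sum_i `|dual_map u 0 i| `^ p = lp_norm q u `^ p.
  rewrite [LHS]/lp_norm E -powRrM mulfV ?gt_eqF// powRr1//; exact: ltW.
under eq_bigr do rewrite mxE.
have nX := lp_normX u q0.
move: (lp_norm q u) n0 nX => n n0 nX.
transitivity (n `^ ((2 - q) * p) * n `^ q).
  rewrite nX mulr_sumr; apply: eq_bigr => i _.
  rewrite normrM powRM// ger0_norm ?powR_ge0// -powRrM; congr (_ * _).
  rewrite normrM ger0_norm ?powR_ge0// [q - 2](_ : _ = (q - 1) - 1); last by lra.
  rewrite powR_normM; last by move: q2; lra.
  by rewrite -powRrM; congr (_ `^ _); rewrite mulrBl mul1r mulrC -pqE; lra.
rewrite -powRD; last by rewrite (gt_eqF n0) implybT.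
by congr (_ `^ _); rewrite mulrBl (mulrC q) -pqE; lra.
Qed.

(** Hoelder's inequality bounds the pairing with [v] because [dual_map] carries the
    q-norm of [u] to the p-norm of its image. *)
Lemma dual_map_convex u v :
  lp_norm q u ^+ 2 / 2 + dotprod (dual_map u) (v - u) <= lp_norm q v ^+ 2 / 2.
Proof.
have := dotprod_le_lp_norm (dual_map u) v p0 q0 pq.
rewrite lp_norm_dual_map !dotprodE dotprod_dual_map.
move: (lp_norm q u) (lp_norm q v) (dotprod _ _) => a b c.
by have := sqr_ge0 (a - b); rewrite sqrrB; lra.
Qed.

End DualityMap.

(** * Calculus on the line *)

Section Calculus.
Context {R : realType}.

Lemma le_of_derive_le (h h' : R -> R) (c : R) :
  (forall t : R, is_derive t 1 h (h' t)) ->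
  (forall t, 0 <= t <= 1 -> h' t <= c) ->
  forall t, 0 <= t <= 1 -> h t <= h 0 + c * t.
Proof.
move=> dh h'_le t /andP[t0 t1].
pose k := h - c *: (id : R -> R).
have dk (s : R) : is_derive s 1 k (h' s - c).
  have d1 : is_derive s 1 (c *: (id : R -> R)) c.
    by apply: is_derive_eq; rewrite scaler1.
  exact: is_deriveB.
have : k t <= k 0.
  apply: (@ler0_derive1_le_cc _ k 0 1).
  - by move=> s _; case: (dk s).
  - move=> s; rewrite in_itv/= => /andP[s0 s1].
    rewrite derive1E; case: (dk s) => _ ->.
    by rewrite subr_le0; apply: h'_le; rewrite !ltW.
  - by apply: derivable_within_continuous => s _; case: (dk s).
  - by rewrite in_itv/= t0.
  - by rewrite in_itv/= ler01 lexx.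
  - exact: t0.
rewrite /k !fctE /GRing.scale/=; lra.
Qed.

(** The form of Taylor's bound shared by the smoothness of the squared norm and
    by the descent lemma: both know the derivative along a segment only through
    its linear growth. *)
Lemma le_of_derive_le_linear (h h' : R -> R) (c : R) :
  (forall t : R, is_derive t 1 h (h' t)) ->
  (forall t, 0 <= t <= 1 -> h' t <= h' 0 + c * t) ->
  h 1 <= h 0 + h' 0 + c / 2.
Proof.
move=> dh h'_le.
have dk (t : R) :
    is_derive t 1 (h - (c / 2) *: ((id : R -> R) ^+ 2)) (h' t - c * t).
  have d2 : is_derive t 1 ((c / 2) *: ((id : R -> R) ^+ 2)) (c * t).
    by apply: is_derive_eq; rewrite /= /GRing.scale/= expr1; field.
  exact: is_deriveB.
have := le_of_derive_le dk _ (t := 1).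
move=> /(_ (h' 0)); rewrite lexx ler01 !fctE /GRing.scale/= => H.
have {H} := H _ isT; rewrite expr1n expr0n/= => H.
have {}H : h 1 - c / 2 * 1 <= h 0 - c / 2 * 0 + h' 0 * 1.
  by apply: H => t t01; rewrite lerBlDr h'_le.
lra.
Qed.

Lemma is_derive_affine (a b t : R) : is_derive t 1 (fun s => a + s * b) b.
Proof.
rewrite (_ : (fun s => _) = (cst a : R -> R) + b *: (id : R -> R)); last first.
  by apply/funext => s; rewrite !fctE /GRing.scale/= mulrC.
apply: is_derive_eq (is_deriveD (is_derive_cst a t 1)
  (is_deriveZ b (is_derive_id t 1))) _.
by rewrite /GRing.scale/= add0r mulr1.
Qed.

(** At 0, where the power itself need not be differentiable, the difference
    quotient is `|h| `^ s, which tends to 0. *)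
Lemma is_derive_powR_normM (s x : R) : 0 < s ->
  is_derive x 1 (fun y => `|y| `^ s * y) ((s + 1) * `|x| `^ s).
Proof.
move=> s0.
have pos (y : R) : 0 < y ->
    is_derive y 1 (fun y => `|y| `^ s * y) ((s + 1) * `|y| `^ s).
  move=> y0; apply: (@near_eq_is_derive _ _ _ (fun z => z `^ (s + 1))).
    near=> z; have z0 : 0 < z by near: z; exact: lt_nbhsr.
    by rewrite gtr0_norm// -[in LHS](mulr_powRB1 (ltW z0)) ?addrK ?addr_gt0// mulrC.
  apply: is_derive_eq (is_derive1_powR (s + 1) y0) _.
  by rewrite addrK gtr0_norm.
have [x0|x0|->] := ltrgtP x 0.
- have nx0 : 0 < - x by rewrite oppr_gt0.
  have dN : is_derive x 1 (-%R : R -> R) (- 1) by exact: is_deriveNid.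
  rewrite (_ : (fun y => _) = - ((fun y => `|y| `^ s * y) \o -%R)); last first.
    by apply/funext => y; rewrite !fctE/= normrN mulrN opprK.
  apply: is_derive_eq (is_deriveN (is_derive1_comp (pos _ nx0) dN)) _.
  by rewrite normrN mulrN1 opprK.
- exact: pos.
- rewrite normr0 powR0 ?gt_eqF// mulr0.
  suff cv : (fun h : R => h^-1 *: (((fun y : R => `|y| `^ s * y) \o shift 0)
      (h *: (1 : R)) - `|0 : R| `^ s * 0)) @ (0 : R)^' --> (0 : R).
    split; first by apply/cvg_ex; exists 0.
    exact/cvg_lim.
  apply/cvgr0Pnorm_lt => e e0; near=> h.
  have h0 : h != 0 by near: h; exact: nbhs_dnbhs_neq.
  rewrite /= normr0 mulr0 subr0 addr0 /GRing.scale/= mulr1.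
  rewrite mulrCA mulVf// mulr1 ger0_norm ?powR_ge0//.
  have -> : e = (e `^ s^-1) `^ s by rewrite -powRrM mulVf ?gt_eqF// powRr1 ?ltW.
  apply: gt0_ltr_powR; rewrite ?nnegrE ?powR_ge0//.
  near: h; apply: dnbhs0_lt; exact: powR_gt0.
Unshelve. all: by end_near. Qed.

Lemma is_derive_powR_norm (r x : R) : 2 < r ->
  is_derive x 1 (fun y => `|y| `^ r) (r * (`|x| `^ (r - 2) * x)).
Proof.
move=> r2.
have r20 : 0 < r - 2 by rewrite subr_gt0.
rewrite (_ : (fun y => _) = (fun y => `|y| `^ (r - 2) * y) * id); last first.
  apply/funext => y; rewrite !fctE -mulrA -expr2 -[y ^+ 2]real_normK ?num_real//.
  rewrite -powR_mulrn// -powRD ?subrK//.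
  by apply/implyP; rewrite gt_eqF// (lt_trans _ r2).
have dy := is_derive_powR_normM x r20.
apply: is_derive_eq (is_deriveM dy (is_derive_id x 1)) _.
by rewrite /GRing.scale/=; ring.
Qed.

End Calculus.

(** * Smoothness of the squared norm *)

Section Smoothness.
Context {R : realType} {d : nat}.
Variable q : R.
Hypothesis q2 : 2 < q.
Implicit Types (u v : 'rV[R]_d).

Let q0 : 0 < q. Proof. by move: q2; lra. Qed.

(** Hoelder's inequality with exponents q / (q - 2) and q / 2. *)
Lemma sum_weighted_sqr_le u v :
  \sum_i `|u 0 i| `^ (q - 2) * v 0 i ^+ 2 <=
    (\sum_i `|u 0 i| `^ q) `^ (1 - 2 / q) * lp_norm q v ^+ 2.
Proof.
have q20 : 0 < q - 2 by rewrite subr_gt0.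
have -> : lp_norm q v ^+ 2 = (\sum_i `|v 0 i| `^ q) `^ (2 / q).
  by rewrite -powR_mulrn ?lp_norm_ge0// -powRrM mulrC.
have := @sum_hoelder R d (q / (q - 2)) (q / 2)
  (fun i => `|u 0 i| `^ (q - 2)) (fun i => v 0 i ^+ 2).
rewrite !divr_gt0// => /(_ isT isT).
have -> : (q / (q - 2))^-1 = 1 - 2 / q.
  by field; rewrite !gt_eqF.
have -> : (q / 2)^-1 = 2 / q by field; rewrite !gt_eqF.
rewrite subrK => /(_ erefl).
move=> /(_ (fun i => powR_ge0 _ _) (fun i => sqr_ge0 _)).
under [X in _ <= X `^ _ * _ -> _]eq_bigr => i _.
  rewrite -powRrM (_ : (q - 2) * _ = q); last by field; rewrite !gt_eqF.
  over.
under [X in _ <= _ * X `^ _ -> _]eq_bigr => i _.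
  rewrite -[v 0 i ^+ 2]real_normK ?num_real// -powR_mulrn// -powRrM.
  rewrite (_ : 2 * _ = q); last by field.
  over.
by [].
Qed.

(** Along the line u + t v the half squared norm is S ^ (2 / q) / 2, where S is the
    sum of the q-th powers. Its second derivative has two terms: the one with the
    square of S' is nonpositive because 2 / q < 1, and the other is at most
    (q - 1) * |v|^2 by [sum_weighted_sqr_le]. The constant does not depend on the
    dimension. *)
Lemma lp_norm_sqr_smooth u v :
  lp_norm q (u + v) ^+ 2 / 2 <=
    lp_norm q u ^+ 2 / 2 + dotprod (dual_map q u) v
      + (q - 1) * lp_norm q v ^+ 2 / 2.
Proof.
(* S has real powers with derivatives only where it is positive; a line through
   the origin is treated apart, by homogeneity. *)
have [[t ut]|un0] := pselect (exists t, u + t *: v = 0).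
  have {ut} -> : u = (- t) *: v by apply/eqP; rewrite scaleNr -addr_eq0 ut.
  rewrite -{2}(scale1r v) -scalerDl !lp_normZ//.
  have -> : dotprod (dual_map q ((- t) *: v)) v = - t * lp_norm q v ^+ 2.
    have [->|t0] := eqVneq t 0.
      rewrite oppr0 scale0r mul0r /dotprod big1// => i _.
      by rewrite !mxE mulr0 mulr0 mul0r.
    apply: (mulfI (x := - t)); first by rewrite oppr_eq0.
    rewrite -dotprodZr dotprod_dual_map// lp_normZ// exprMn real_normK ?num_real//.
    by rewrite [RHS]mulrA -expr2.
  rewrite !exprMn !real_normK ?num_real//.
  have := sqr_ge0 (lp_norm q v).
  move: (lp_norm q v ^+ 2) => n n0.
  have : 0 <= (q - 2) * n by rewrite mulr_ge0// subr_ge0 ltW.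
  nra.
pose w (i : 'I_d) := fun t : R => u 0 i + t * v 0 i.
pose S t := \sum_i `|w i t| `^ q.
pose T t := \sum_i `|w i t| `^ (q - 2) * w i t * v 0 i.
pose V t := \sum_i `|w i t| `^ (q - 2) * v 0 i ^+ 2.
have SE t : S t = \sum_i `|(u + t *: v) 0 i| `^ q.
  by apply: eq_bigr => i _; rewrite !mxE.
have S0 t : 0 < S t.
  rewrite SE lt_neqAle sumr_ge0 ?andbT; last by move=> i _; exact: powR_ge0.
  apply/eqP => /esym S0; apply: un0; exists t.
  apply: (lp_norm_eq0 q0); rewrite /lp_norm S0 powR0//.
  by rewrite invr_eq0 gt_eqF.
have dw i (t : R) : is_derive t 1 (w i) (v 0 i).
  exact: is_derive_affine.
have dS (t : R) : is_derive t 1 S (q * T t).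
  rewrite (_ : S = \sum_i ((fun y => `|y| `^ q) \o w i)); last first.
    by apply/funext => s; rewrite fct_sumE.
  rewrite mulr_sumr; apply: is_derive_sum => i.
  apply: is_derive_eq (is_derive1_comp (is_derive_powR_norm _ q2) (dw i t)) _.
  by rewrite !mulrA.
have dT (t : R) : is_derive t 1 T ((q - 1) * V t).
  rewrite (_ : T = \sum_i (v 0 i *: ((fun y => `|y| `^ (q - 2) * y) \o w i)));
    last first.
    by apply/funext => s; rewrite fct_sumE; apply: eq_bigr => i _; rewrite mulrC.
  rewrite mulr_sumr; apply: is_derive_sum => i.
  have q20 : 0 < q - 2 by rewrite subr_gt0.
  apply: is_derive_eq (is_deriveZ _
    (is_derive1_comp (is_derive_powR_normM _ q20) (dw i t))) _.
  by rewrite /GRing.scale/=; ring.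
have dSpow r (t : R) : is_derive t 1 (fun s => S s `^ r) (r * S t `^ (r - 1) * (q * T t)).
  exact: is_derive_eq (is_derive1_comp (is_derive1_powR r (S0 t)) (dS t)) _.
pose h1 t := S t `^ (2 / q - 1) * T t.
have dh (t : R) : is_derive t 1 (fun s => S s `^ (2 / q) / 2) (h1 t).
  rewrite (_ : (fun s => _) = 2^-1 *: (fun s => S s `^ (2 / q))); last first.
    by apply/funext => s; rewrite !fctE /GRing.scale/= mulrC.
  apply: is_derive_eq (is_deriveZ _ (dSpow _ t)) _.
  by rewrite /h1 /GRing.scale/=; field; rewrite gt_eqF.
have h1_le t : 0 <= t <= 1 -> h1 t <= h1 0 + (q - 1) * lp_norm q v ^+ 2 * t.
  move=> t01; pose r := 2 / q - 1.
  have dh1 (s : R) : is_derive s 1 h1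
      (r * q * S s `^ (r - 1) * T s ^+ 2 + (q - 1) * (S s `^ r * V s)).
    apply: is_derive_eq (is_deriveM (dSpow r s) (dT s)) _.
    by rewrite /GRing.scale/=; ring.
  apply: (le_of_derive_le dh1) t01 => s _.
  rewrite -[leRHS]add0r; apply: lerD.
    have -> : r * q = 2 - q by rewrite /r mulrBl mul1r divfK ?gt_eqF//.
    apply: mulr_le0_ge0; last exact: sqr_ge0.
    by apply: mulr_le0_ge0; [rewrite subr_le0 ltW|exact: powR_ge0].
  rewrite ler_wpM2l//; first by move: q2; lra.
  have -> : lp_norm q v ^+ 2 = S s `^ r * (S s `^ (1 - 2 / q) * lp_norm q v ^+ 2).
    rewrite mulrA -powRD; last by rewrite (gt_eqF (S0 s)) implybT.
    by rewrite /r subrKA subrr powRr0 mul1r.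
  rewrite ler_wpM2l ?powR_ge0//.
  have := sum_weighted_sqr_le (u + s *: v) v; rewrite -SE.
  apply: le_trans; rewrite le_eqVlt; apply/orP; left; apply/eqP.
  by apply: eq_bigr => i _; rewrite !mxE.
have h0 : forall t, S t `^ (2 / q) = lp_norm q (u + t *: v) ^+ 2.
  move=> t; rewrite SE -powR_mulrn ?lp_norm_ge0// /lp_norm -powRrM.
  by rewrite [q^-1 * _]mulrC.
have := le_of_derive_le_linear dh h1_le.
rewrite !h0 scale1r scale0r addr0.
suff -> : h1 0 = dotprod (dual_map q u) v by [].
rewrite /h1 /dotprod mulr_sumr; apply: eq_bigr => i _.
rewrite mxE /w mul0r addr0 SE scale0r addr0 -!mulrA.
rewrite /lp_norm -powRrM mulrBr; congr (_ `^ _ * _).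
by rewrite mulVf ?gt_eqF// mulrC.
Qed.

End Smoothness.

(** * Smooth convex functions *)

Section Gradient.
Context {R : realType} {d : nat}.
Variable f : 'rV[R]_d -> R.
Hypothesis df : forall x, differentiable f x.
Implicit Types (x y v : 'rV[R]_d).

Lemma dotprod_grad x v : dotprod (grad f x) v = 'D_v f x.
Proof.
rewrite deriveE// [v in RHS]row_sum_delta linear_sum.
apply: eq_bigr => i _; rewrite !mxE linearZ/= deriveE//.
by rewrite /GRing.scale/= mulrC.
Qed.

Lemma is_derive_along_line x v (t : R) :
  is_derive t 1 (fun s => f (x + s *: v)) (dotprod (grad f (x + t *: v)) v).
Proof.
have E : (fun h : R => h^-1 *: (((fun s => f (x + s *: v)) \o shift t) (h *: 1)
      - f (x + t *: v)))
    = (fun h : R => h^-1 *: ((f \o shift (x + t *: v)) (h *: v) - f (x + t *: v))).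
  apply/funext => h /=; congr (_ *: (f _ - _)).
  by rewrite [h%:A]mulr1 scalerDl addrCA.
have dv : derivable f (x + t *: v) v by exact: diff_derivable.
split; first by rewrite /derivable E.
by rewrite /derive E dotprod_grad.
Qed.

(** The secant slopes of a convex function towards [y] are at most f y - f x, and
    so is their limit. *)
Lemma convex_ge_tangent x y : @convex_function R 'rV[R]_d setT f ->
  f x + dotprod (grad f x) (y - x) <= f y.
Proof.
move=> cf.
have secant (h : R) : 0 < h -> h < 1 ->
    h^-1 * (f (h *: (y - x) + x) - f x) <= f y - f x.
  move=> h0 h1; rewrite ler_pdivrMl//.
  have := cf (Itv01 (ltW h0) (ltW h1)) y x (mem_setT _) (mem_setT _).
  have -> : h *: (y - x) + x = h *: y + (1 - h) *: x.
    by rewrite scalerBr scalerBl scale1r -addrA [- _ + x]addrC.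
  rewrite [X in _ <= X](_ : _ = h * f y + (1 - h) * f x); last by [].
  by rewrite [X in f X <= _](_ : _ = h *: y + (1 - h) *: x)//; lra.
rewrite -lerBrDl dotprod_grad.
have dv : derivable f x (y - x) by exact: diff_derivable.
have cv : (fun h : R => h^-1 *: ((f \o shift x) (h *: (y - x)) - f x))
    @ (0 : R)^'+ --> 'D_(y - x) f x.
  exact: cvg_dnbhs_at_right dv.
apply: (cvgr_to_le cv); near=> h.
by apply: secant; near: h; [exact: nbhs_right_gt|exact: nbhs_right_lt].
Unshelve. all: by end_near. Qed.

Lemma smooth_le_quadratic (p q M : R) x y : 0 < p -> 0 < q -> p^-1 + q^-1 = 1 ->
  (forall x y, lp_norm q (grad f x - grad f y) <= M * lp_norm p (x - y)) ->
  f y <= f x + dotprod (grad f x) (y - x) + M / 2 * lp_norm p (y - x) ^+ 2.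
Proof.
move=> p0 q0 pq Lip; set v := y - x.
have := le_of_derive_le_linear (is_derive_along_line x v).
move=> /(_ (M * lp_norm p v ^+ 2)); rewrite scale1r scale0r !addr0 subrKC mulrAC.
apply=> t /andP[t0 _]; rewrite -lerBlDl.
rewrite -dotprodNl -dotprodDl.
have := dotprod_le_lp_norm v (grad f (x + t *: v) - grad f x) p0 q0 pq.
rewrite dotprodC => /le_trans; apply.
have := Lip (x + t *: v) x.
rewrite addrAC subrr add0r lp_normZ// ger0_norm//.
have := lp_norm_ge0 p v.
move: (lp_norm p v) (lp_norm q _) => a b a0 b_le.
by rewrite mulrC (le_trans (ler_wpM2r a0 b_le))// expr2; lra.
Qed.

End Gradient.

Section Cocoercivity.
Context {R : realType} {d : nat}.

(** The function f - <grad f Y, -> is minimal at Y. Its value there is therefore at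
    most its value after the best step from X allowed by the quadratic upper bound,
    and that step gains |grad f X - grad f Y|^2 / (2 M). A Lipschitz constant L
    with L <= M serves as well as M, so a failed test forces M < L. *)
Lemma smooth_convex_cocoercive (p q L M : R) (f : 'rV[R]_d -> R) X Y :
  0 < p -> 2 < q -> p^-1 + q^-1 = 1 -> 0 < M -> L <= M ->
  (forall x, differentiable f x) -> @convex_function R 'rV[R]_d setT f ->
  (forall x y, lp_norm q (grad f x - grad f y) <= L * lp_norm p (x - y)) ->
  cocoercive_at q M f X Y.
Proof.
move=> p0 q2 pq M0 LM df cf Lip.
have q0 : 0 < q by lra.
have LipM x y : lp_norm q (grad f x - grad f y) <= M * lp_norm p (x - y).
  by apply: le_trans (Lip x y) _; rewrite ler_wpM2r// lp_norm_ge0.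
pose delta := grad f X - grad f Y.
pose z := X - M^-1 *: dual_map q delta.
have lower := convex_ge_tangent df Y z cf.
have upper := smooth_le_quadratic df X z p0 q0 pq LipM.
have zX : z - X = (- M^-1) *: dual_map q delta.
  by rewrite /z addrAC subrr add0r scaleNr.
have zY : z - Y = (X - Y) + (- M^-1) *: dual_map q delta.
  by rewrite -zX [RHS]addrC subrKA.
rewrite zX lp_normZ// normrN ger0_norm ?invr_ge0 ?(ltW M0)// in upper.
rewrite lp_norm_dual_map// in upper.
rewrite zY in lower.
have self := dotprod_dual_map q2 delta.
have selfE : lp_norm q delta ^+ 2 / M = M^-1 * dotprod (grad f X) (dual_map q delta)
    - M^-1 * dotprod (grad f Y) (dual_map q delta).
  by rewrite -self dotprodC /delta !dotprodE; ring.
rewrite /cocoercive_at -/delta.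
move: lower upper selfE; rewrite !dotprodE.
have -> : M / 2 * (M^-1 * lp_norm q delta) ^+ 2 = lp_norm q delta ^+ 2 / M / 2.
  by move: (lp_norm q delta) => n; field; rewrite gt_eqF.
have -> : lp_norm q delta ^+ 2 / (2 * M) = lp_norm q delta ^+ 2 / M / 2.
  by move: (lp_norm q delta) => n; field; rewrite gt_eqF.
move: (lp_norm q delta ^+ 2 / M) => n.
move: (dotprod _ (dual_map q delta)) (dotprod _ (dual_map q delta)) => a b.
lra.
Qed.

End Cocoercivity.

(** * Step coefficients *)

Section StepCoefficients.
Context {R : realType}.

(** The largest sequence for which the prediction error of the extrapolation phase,
    of weight beta_k ^ 2, is paid by the tests: the partial sums beta_k ^ 2 grow by
    beta_k. *)
Fixpoint rising_coef (k : nat) : R :=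
  if k is k'.+1 then Num.sqrt (rising_coef k' ^+ 2 + rising_coef k') else 1.

(** The analogous sequence for the averaging phase, indexed by the number of steps
    left: e_r is the larger root of e ^ 2 - e = e_(r-1) ^ 2. *)
Fixpoint falling_coef (r : nat) : R :=
  if r is r'.+1 then 2^-1 + Num.sqrt (4^-1 + falling_coef r' ^+ 2) else 0.

Lemma rising_coef_gt0 k : 0 < rising_coef k.
Proof.
by elim: k => [//|k IH]; rewrite sqrtr_gt0 addr_gt0// exprn_gt0.
Qed.

Lemma rising_coefS k :
  rising_coef k.+1 ^+ 2 = rising_coef k ^+ 2 + rising_coef k.
Proof. by rewrite sqr_sqrtr// addr_ge0 ?sqr_ge0// ltW// rising_coef_gt0. Qed.

Lemma falling_coef_ge0 r : 0 <= falling_coef r.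
Proof. by case: r => [//|r]; rewrite addr_ge0 ?sqrtr_ge0 ?invr_ge0. Qed.

Lemma falling_coefS r :
  falling_coef r.+1 ^+ 2 = falling_coef r.+1 + falling_coef r ^+ 2.
Proof.
rewrite /=; set e := falling_coef r; set s := Num.sqrt _.
have : s ^+ 2 = 4^-1 + e ^+ 2 by rewrite sqr_sqrtr// addr_ge0 ?sqr_ge0 ?invr_ge0.
by move: s => s sE; rewrite sqrrD sE; field.
Qed.

Lemma falling_coef_geS r : falling_coef r + 2^-1 <= falling_coef r.+1.
Proof.
rewrite /= [leLHS]addrC lerD2l -[leLHS]ger0_norm ?falling_coef_ge0//.
by rewrite -sqrtr_sqr ler_wsqrtr// lerDr invr_ge0.
Qed.

Lemma falling_coefS_ge1 r : 1 <= falling_coef r.+1.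
Proof.
have := falling_coefS r; have := falling_coef_geS r.
have := falling_coef_ge0 r; move: (falling_coef r) (falling_coef r.+1).
move=> a b; nra.
Qed.

Lemma falling_coef1 : falling_coef 1 = 1.
Proof.
rewrite /= expr0n/= addr0 (_ : 4^-1 = 2^-1 ^+ 2); last by field.
by rewrite sqrtr_sqr ger0_norm ?invr_ge0//; field.
Qed.

(** One step of both recursions raises the squared product e ^ 2 * b ^ 2 to at least
    the right-hand side, whereas an increase of r = sqrt (e * b) by exactly 1/2 would
    require (r + 1/2) ^ 4. The shortfall grows linearly with the imbalance r - b, while
    the excess of the arithmetic over the geometric mean of e and b contributes a term
    quadratic in it; at worst r / 4 + 3 / 16 is missing. *)
Lemma quartic_growth (e b r : R) : 0 < e -> 0 < b -> 0 < r -> r ^+ 2 = e * b ->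
  (r + 2^-1) ^+ 4 - (r / 4 + 3 / 16) <= (e ^+ 2 + e + 2^-1) * (b ^+ 2 + b).
Proof.
move=> e0 b0 r0 rE.
have -> : (e ^+ 2 + e + 2^-1) * (b ^+ 2 + b) =
    r ^+ 4 + r ^+ 2 * (e + b) + r ^+ 2 + (b ^+ 2 + b) / 2.
  have -> : r ^+ 4 = (e * b) ^+ 2 by rewrite -rE; ring.
  by rewrite rE; field.
have amgm : (e + b - 2 * r) * b = (r - b) ^+ 2 by rewrite sqrrB rE; ring.
have k0 : 0 <= e + b - 2 * r by rewrite -(pmulr_lge0 _ b0) amgm sqr_ge0.
have [br|rb] := lerP b r.
  have : r * (r - b) ^+ 2 <= r ^+ 2 * (e + b - 2 * r).
    by rewrite -amgm expr2 -mulrA ler_pM2l// mulrC ler_wpM2r.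
  have : 0 <= (r + 2^-1) * (r - b - 2^-1) ^+ 2.
    by rewrite mulr_ge0 ?sqr_ge0// addr_ge0 ?ltW.
  lra.
have : 0 <= r ^+ 2 * (e + b - 2 * r) by rewrite mulr_ge0 ?sqr_ge0.
nra.
Qed.

(** Each of the two sequences is n / 2 up to a logarithmic correction, and the two
    corrections have opposite signs; this is why only the product has a clean
    bound. The shortfall of [quartic_growth] lowers the increase of sqrt (e * b) by
    a summable amount, which the term 1 / (4 m), with m = n + 2, absorbs. *)
Lemma coef_product_ge n :
  ((n.+2)%:R / 2 + (4 * (n.+2)%:R)^-1) ^+ 2 <=
    falling_coef n.+1 * rising_coef n.+1.
Proof.
elim: n => [|n IH].
  rewrite falling_coef1 mul1r /= expr1n.
  rewrite -[leLHS]ger0_norm ?sqr_ge0// -sqrtr_sqr ler_wsqrtr//.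
  lra.
set e := falling_coef n.+1 in IH *; set b := rising_coef n.+1 in IH *.
have e0 : 0 < e by apply: lt_le_trans (falling_coefS_ge1 n).
have b0 : 0 < b by exact: rising_coef_gt0.
have m0 : 0 < (n.+2)%:R :> R by rewrite ltr0n.
rewrite -(natr1 n.+2) in IH *.
move: (n.+2)%:R m0 IH => m m0 IH.
pose r := Num.sqrt (e * b).
have rE : r ^+ 2 = e * b by rewrite sqr_sqrtr// mulr_ge0// ltW.
have r0 : 0 < r by rewrite sqrtr_gt0 mulr_gt0.
have growth := quartic_growth e0 b0 r0 rE.
set rho := m / 2 + (4 * m)^-1 in IH *.
have rho0 : 0 < rho by rewrite addr_gt0 ?divr_gt0 ?invr_gt0 ?mulr_gt0.
have rho_le : rho <= r.
  by rewrite -(ger0_norm (ltW rho0)) -sqrtr_sqr ler_wsqrtr.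
set rho' := (m + 1) / 2 + (4 * (m + 1))^-1.
have m10 : 0 < m + 1 by rewrite addr_gt0.
have rho'0 : 0 < rho' by rewrite addr_gt0 ?divr_gt0 ?invr_gt0 ?mulr_gt0.
have E0 : 0 <= falling_coef n.+2 * rising_coef n.+2.
  by rewrite mulr_ge0 ?falling_coef_ge0// ltW ?rising_coef_gt0.
rewrite -(@ler_pXn2r _ 2) ?nnegrE ?sqr_ge0// [leRHS]exprMn rising_coefS -/b.
have e2 : e ^+ 2 + e + 2^-1 <= falling_coef n.+2 ^+ 2.
  by rewrite falling_coefS -/e; have := falling_coef_geS n.+1; rewrite -/e; lra.
have bb0 : 0 <= b ^+ 2 + b by rewrite addr_ge0 ?sqr_ge0 ?ltW.
apply: le_trans (ler_wpM2r bb0 e2); apply: le_trans growth.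
have quart (x y : R) : 0 < y -> 4 * y ^+ 3 * (x - y) <= x ^+ 4 - y ^+ 4.
  move=> y0; have : 0 <= (x - y) ^+ 2 * (2 * y ^+ 2 + (x + y) ^+ 2).
    by rewrite mulr_ge0 ?sqr_ge0// addr_ge0 ?sqr_ge0// mulr_ge0 ?sqr_ge0.
  lra.
have step1 : rho / 4 + 3 / 16 <= (rho + 2^-1) ^+ 4 - rho' ^+ 4.
  apply: le_trans (quart _ _ rho'0).
  (* The summable loss 1 / (4 m) - 1 / (4 (m + 1)). *)
  have -> : rho + 2^-1 - rho' = (4 * m * (m + 1))^-1.
    by rewrite /rho /rho'; field; rewrite !gt_eqF.
  have : ((m + 1) / 2) ^+ 3 <= rho' ^+ 3.
    by rewrite ler_pXn2r ?nnegrE ?ltW ?divr_gt0// /rho' ltrDl invr_gt0 mulr_gt0.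
  have i0 : 0 < (4 * m * (m + 1))^-1 by rewrite invr_gt0 !mulr_gt0.
  move=> /(ler_wpM2r (ltW i0)) cube_le.
  have : rho / 4 + 3 / 16 <= 4 * (((m + 1) / 2) ^+ 3 * (4 * m * (m + 1))^-1).
    have -> : 4 * (((m + 1) / 2) ^+ 3 * (4 * m * (m + 1))^-1) =
        m / 8 + 1 / 4 + m^-1 / 8 by field; rewrite !gt_eqF.
    have -> : rho = m / 2 + m^-1 / 4 by rewrite /rho; field; rewrite gt_eqF.
    have : 0 < m^-1 by rewrite invr_gt0.
    lra.
  lra.
have step2 : (r - rho) / 4 <= (r + 2^-1) ^+ 4 - (rho + 2^-1) ^+ 4.
  have h0 : 0 < rho + 2^-1 by rewrite addr_gt0.
  apply: le_trans (quart _ _ h0).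
  rewrite (_ : r + _ - _ = r - rho); last by ring.
  rewrite mulrC ler_wpM2r ?subr_ge0//.
  have : 2^-1 ^+ 3 <= (rho + 2^-1) ^+ 3.
    by rewrite ler_pXn2r ?nnegrE ?invr_ge0 ?(ltW h0)// lerDr ltW.
  lra.
rewrite -exprM; lra.
Qed.

Lemma sqr_le_coef_product n :
  n%:R ^+ 2 / 4 <= falling_coef n * rising_coef n.
Proof.
case: n => [|n]; first by rewrite /= expr0n !mul0r.
apply: le_trans (coef_product_ge n).
rewrite -(natr1 n.+1); have : 0 <= n.+1%:R :> R by exact: ler0n.
move: (n.+1)%:R => x x0.
have : 0 < (4 * (x + 1))^-1 by rewrite invr_gt0 mulr_gt0// ltr_pwDr.
move: (_^-1) => y y0; nra.
Qed.

End StepCoefficients.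

Arguments rising_coef {R} k : simpl never.
Arguments falling_coef {R} r : simpl never.

(** * The two phases and their rates *)

Section Schemes.
Context {R : realType} {d : nat}.

Record state := State
  { iterate : 'rV[R]_d; gradient : 'rV[R]_d; dual : 'rV[R]_d }.

(** A first-order method driven by a list of coefficients: the same induction on
    that list then covers a coefficient index that rises during the first phase and
    one that falls during the second. *)
Record scheme := Scheme
  { next : R -> state -> 'rV[R]_d;
    absorb : R -> state -> 'rV[R]_d -> 'rV[R]_d }.

Definition observe (S : scheme) (c : R) (m : state) (gy : 'rV[R]_d) : state :=
  State (next S c m) gy (absorb S c m gy).

Variable (g : 'rV[R]_d -> 'rV[R]_d).

Fixpoint play (S : scheme) (cs : seq R) (m : state) : state :=
  if cs is c :: cs' then play S cs' (observe S c m (g (next S c m))) else m.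

Fixpoint passes (C : rel 'rV[R]_d) (S : scheme) (cs : seq R) (m : state) : bool :=
  if cs is c :: cs' then
    C (iterate m) (next S c m) && passes C S cs' (observe S c m (g (next S c m)))
  else true.

Variables (J : 'rV[R]_d -> 'rV[R]_d) (kappa : R).

(** Dual averaging with a prediction: the weight kappa * c of the coming gradient is
    already given to the current one when the mirror point
    x0 - J (dual + kappa * c * gradient) is formed. *)
Definition extrapolation (x0 : 'rV[R]_d) : scheme := Scheme
  (fun c m => (c + 1)^-1 *: (c *: iterate m
     + (x0 - J (dual m + (kappa * c) *: gradient m))))
  (fun c m gy => dual m + (kappa * c) *: gy).

(** The time reversal of [extrapolation]. The dual variable is a running average of
    the gradients; its last coefficient is 1, so it ends at the last gradient. *)
Definition averaging : scheme := Scheme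
  (fun e m => iterate m
     - (kappa * e) *: J (dual m + e^-1 *: (gradient m - dual m)))
  (fun e m gy => dual m + e^-1 *: (gy - dual m)).

Definition rising_coefs k n : seq R := [seq rising_coef i | i <- iota k n].

Fixpoint falling_coefs r : seq R :=
  if r is r'.+1 then falling_coef r'.+1 :: falling_coefs r' else [::].

End Schemes.

Arguments state : clear implicits.
Arguments scheme : clear implicits.

Section CoefficientLists.
Context {R : realType}.

Lemma size_rising_coefs k n : size (rising_coefs k n : seq R) = n.
Proof. by rewrite size_map size_iota. Qed.

Lemma size_falling_coefs r : size (falling_coefs r : seq R) = r.
Proof. by elim: r => //= r ->. Qed.

End CoefficientLists.

(** The analysis uses of the two norms only what is assumed here: [J] is the gradient
    of half the square of [nq], which is smooth with constant 1 / sigma. *)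
Section MirrorMap.
Context {R : realType} {d : nat}.
Variables (nq : 'rV[R]_d -> R) (J : 'rV[R]_d -> 'rV[R]_d) (sigma : R).
Hypothesis nqZ : forall c u, nq (c *: u) ^+ 2 = c ^+ 2 * nq u ^+ 2.
Hypothesis J_self : forall u, dotprod (J u) u = nq u ^+ 2.
Hypothesis J_convex : forall u v,
  nq u ^+ 2 / 2 + dotprod (J u) (v - u) <= nq v ^+ 2 / 2.
Hypothesis J_smooth : forall u v,
  nq (u + v) ^+ 2 / 2 <=
    nq u ^+ 2 / 2 + dotprod (J u) v + nq v ^+ 2 / (2 * sigma).
Variables (f : 'rV[R]_d -> R) (g : 'rV[R]_d -> 'rV[R]_d) (M : R).
Hypotheses (sigma0 : 0 < sigma) (M0 : 0 < M).
Hypothesis tangent : forall x y, f x + dotprod (g x) (y - x) <= f y.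
Implicit Types (x y z u v h s : 'rV[R]_d).

Let coco x y := nq (g x - g y) ^+ 2 / (2 * M) <= f x - f y - dotprod (g y) (x - y).

(** Both phases evaluate [J] at a prediction [h] of the new dual point [v]. Smoothness
    compares [v] with [h], convexity compares [u] with [h], and only the squared
    prediction error is lost. *)
Lemma sqr_norm_hint h u v :
  nq v ^+ 2 / 2 <=
    nq u ^+ 2 / 2 + dotprod (J h) (v - u) + nq (v - h) ^+ 2 / (2 * sigma).
Proof.
have := J_smooth h (v - h); have := J_convex h u.
rewrite subrKC !dotprodE; lra.
Qed.

(** [J] at twice [u] pairs with [u] to half the square of nq (2 u), which is also the
    value that smoothness starts from. The square of [u] left by [sqr_norm_hint]
    therefore disappears, and the first gradient costs nothing. *)
Lemma sqr_norm_hint_double u v :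
  nq v ^+ 2 / 2 <=
    dotprod (J (2 *: u)) (v - u) + nq (v - 2 *: u) ^+ 2 / (2 * sigma).
Proof.
have := J_smooth (2 *: u) (v - 2 *: u); have := J_self (2 *: u).
rewrite subrKC !dotprodE; lra.
Qed.

(** Test inequality with weight (sigma / M) c ^ 2 plus tangent inequality towards [z]
    with weight (sigma / M) c. The weights are such that the test pays exactly for
    the prediction error nq (s' - h) ^ 2 / (2 * sigma). *)
Lemma extrapolation_step (c : R) x0 x s z :
  0 < c ->
  let h := s + (sigma / M * c) *: g x in
  let y := (c + 1)^-1 *: (c *: x + (x0 - J h)) in
  let s' := s + (sigma / M * c) *: g y in
  coco x y ->
  sigma / M * (c ^+ 2 + c) * (f y - f z) - dotprod s' (x0 - z)
    + dotprod (J h) (s' - s) + nq (s' - h) ^+ 2 / (2 * sigma)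
  <= sigma / M * c ^+ 2 * (f x - f z) - dotprod s (x0 - z).
Proof.
move=> c0 h y s'; rewrite /coco => cxy.
have Jh : J h = c *: x + x0 - (c + 1) *: y.
  rewrite /y scalerA mulfV ?gt_eqF ?addr_gt0// scale1r addrA.
  by rewrite opprD opprK addrA subrr add0r.
have E : s' - h = (- (sigma / M * c)) *: (g x - g y).
  rewrite /s' /h opprD addrACA subrr add0r -scalerBr scaleNr -scalerN opprB//.
have {}cxy := ler_wpM2l (ltW (mulr_gt0 (divr_gt0 sigma0 M0) (exprn_gt0 2 c0))) cxy.
have t := ler_wpM2l (ltW (mulr_gt0 (divr_gt0 sigma0 M0) c0)) (tangent y z).
have Es : s' - s = (sigma / M * c) *: g y by rewrite /s' addrAC subrr add0r.
rewrite E Es nqZ Jh {Jh E Es}.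
move: cxy t; rewrite -/y; clearbody y; rewrite {}/s' {}/h.
rewrite !dotprodE.
have -> : (- (sigma / M * c)) ^+ 2 * nq (g x - g y) ^+ 2 / (2 * sigma) =
    sigma / M * c ^+ 2 * (nq (g x - g y) ^+ 2 / (2 * M)).
  by field; rewrite !gt_eqF.
move: (nq _ ^+ 2 / _) (sigma / M) => n a.
rewrite ![dotprod _ (g y)]dotprodC; lra.
Qed.

(** As in [extrapolation_step], the test between [x] and [y] pays for the error of
    predicting the new average [Q'] by [h]. *)
Lemma averaging_step (e : R) x y Q z :
  0 < e ->
  let h := Q + e^-1 *: (g x - Q) in
  let Q' := Q + e^-1 *: (g y - Q) in
  y = x - (sigma / M * e) *: J h ->
  coco x y ->
  M / (sigma * e ^+ 2) * (f y - f z + dotprod Q (z - y)) + nq Q' ^+ 2 / 2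
  <= M / (sigma * e ^+ 2) * (f x - f z + dotprod Q (z - x)) + nq Q ^+ 2 / 2.
Proof.
move=> e0 h Q' yE; rewrite /coco => cxy.
have w0 : 0 < M / (sigma * e ^+ 2) by rewrite divr_gt0 ?mulr_gt0 ?exprn_gt0.
have hint := sqr_norm_hint h Q Q'.
have E : Q' - h = - e^-1 *: (g x - g y).
  rewrite /Q' /h opprD addrACA subrr add0r -scalerBr scaleNr -scalerN opprB.
  by congr (_ *: _); rewrite opprB addrA subrK.
have {}yE : J h = (sigma / M * e)^-1 *: (x - y).
  rewrite yE opprB addrC subrK scalerA mulVf ?scale1r//.
  by rewrite !mulf_neq0 ?invr_eq0 ?gt_eqF.
have {}cxy := ler_wpM2l (ltW w0) cxy.
move: hint; rewrite E nqZ {E} yE {yE}.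
rewrite (_ : Q' - Q = e^-1 *: (g y - Q)); last by rewrite /Q' addrAC subrr add0r.
rewrite dotprodZl dotprodZr mulrA.
have -> : (sigma / M * e)^-1 * e^-1 = M / (sigma * e ^+ 2).
  by field; rewrite !gt_eqF.
have -> : (- e^-1) ^+ 2 * nq (g x - g y) ^+ 2 / (2 * sigma) =
    M / (sigma * e ^+ 2) * (nq (g x - g y) ^+ 2 / (2 * M)).
  by field; rewrite !gt_eqF.
clearbody h Q'; move: cxy.
move: (nq _ ^+ 2 / (2 * M)) (M / _) => n a.
rewrite !dotprodE ![dotprod _ (g y)]dotprodC ![dotprod _ Q]dotprodC; lra.
Qed.

(** The potential below is nonincreasing from the first step on. Before that step it
    would contain the square of the first dual point, which
    [sqr_norm_hint_double] avoids. *)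
Lemma extrapolation_phase (C : rel 'rV[R]_d) x0 z n :
  (forall x y, C x y -> coco x y) ->
  let S := extrapolation J (sigma / M) x0 in
  let m0 := State x0 (g x0) ((sigma / M) *: g x0) in
  let m := play g S (rising_coefs 0 n.+1) m0 in
  passes g C S (rising_coefs 0 n.+1) m0 ->
  sigma / M * rising_coef n.+1 ^+ 2 * (f (iterate m) - f z)
    + nq (dual m) ^+ 2 / 2 <= dotprod (dual m) (x0 - z).
Proof.
move=> Ccoco S m0.
pose inv k m := sigma / M * rising_coef k ^+ 2 * (f (iterate m) - f z)
    + nq (dual m) ^+ 2 / 2 <= dotprod (dual m) (x0 - z).
have later k l m : gradient m = g (iterate m) -> inv k m ->
    passes g C S (rising_coefs k l) m -> inv (k + l)%N (play g S (rising_coefs k l) m).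
  elim: l k m => [|l IH] k m mg mk /=; first by rewrite addn0.
  move=> /andP[/Ccoco cxy pass]; rewrite addnS -addSn; apply: IH => //.
  rewrite /inv/= mg in cxy *.
  have := extrapolation_step z (rising_coef_gt0 k) cxy.
  rewrite -rising_coefS /=.
  set h := dual m + _ *: g (iterate m); set y := _ *: (_ + _).
  have := sqr_norm_hint h (dual m) (dual m + (sigma / M * rising_coef k) *: g y).
  move: mk; rewrite /inv.
  lra.
move=> m /= /andP[/Ccoco cxy pass]; apply: (later 1 n _ _ _ pass) => //.
rewrite /inv /= in cxy *.
have := extrapolation_step z ltr01 cxy.
rewrite -[1 ^+ 2 + 1](rising_coefS 0) /=.
set h := (_ *: g x0 + _ *: g x0); set y := _ *: (_ + _).
have -> : h = 2 *: ((sigma / M) *: g x0).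
  by rewrite /h mulr1 scaler_nat mulr2n.
have := sqr_norm_hint_double ((sigma / M) *: g x0)
  ((sigma / M) *: g x0 + (sigma / M * 1) *: g y).
have := ler_wpM2l (ltW (divr_gt0 sigma0 M0)) (tangent x0 z).
rewrite expr1n mulr1 !dotprodE; lra.
Qed.

(** The recursion e ^ 2 = e + e' ^ 2 makes the average [Q'] the combination for which
    the change of weight costs a multiple of the tangent inequality from [y] to
    [z]. *)
Lemma averaging_reweight (e e' : R) y Q z :
  0 < e -> 0 < e' -> e ^+ 2 = e + e' ^+ 2 ->
  M / (sigma * e' ^+ 2)
    * (f y - f z + dotprod (Q + e^-1 *: (g y - Q)) (z - y))
  <= M / (sigma * e ^+ 2) * (f y - f z + dotprod Q (z - y)).
Proof.
move=> e0 e'0 ee'.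
set a := M / (sigma * e' ^+ 2).
have a0 : 0 < a by rewrite divr_gt0 ?mulr_gt0 ?exprn_gt0.
have -> : M / (sigma * e ^+ 2) = a * (1 - e^-1).
  have -> : 1 - e^-1 = e' ^+ 2 / e ^+ 2.
    have -> : e' ^+ 2 = e ^+ 2 - e by rewrite ee' addrAC subrr add0r.
    by field; rewrite gt_eqF.
  by rewrite /a; field; rewrite !gt_eqF.
have ae0 : 0 <= a * e^-1 by rewrite mulr_ge0 ?invr_ge0 ?ltW.
have := ler_wpM2l ae0 (tangent y z).
rewrite !dotprodE; lra.
Qed.

(** Induction on the number of steps left, with the final iterate as the comparison
    point throughout. With one step left e = 1, and the last average is the last
    gradient. *)
Lemma averaging_phase (C : rel 'rV[R]_d) n m :
  (forall x y, C x y -> coco x y) ->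
  gradient m = g (iterate m) ->
  let S := averaging J (sigma / M) in
  let m' := play g S (falling_coefs n.+1) m in
  passes g C S (falling_coefs n.+1) m ->
  nq (gradient m') ^+ 2 / 2 <=
    M / (sigma * falling_coef n.+1 ^+ 2) * (f (iterate m) - f (iterate m')
      + dotprod (dual m) (iterate m' - iterate m)) + nq (dual m) ^+ 2 / 2.
Proof.
move=> Ccoco + S; elim: n m => [|n IH] m mg.
  rewrite /= mg falling_coef1; set y := iterate m - _ => /andP[/Ccoco cxy _].
  have := averaging_step y ltr01 (erefl y) cxy; apply: le_trans.
  by rewrite invr1 !scale1r !subrKC !subrr dotprod0r addr0 mulr0 add0r.
have e0 k : 0 < falling_coef k.+1 :> R := lt_le_trans ltr01 (falling_coefS_ge1 k).
pose e := falling_coef n.+2 : R.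
pose m1 := observe S e m (g (next S e m)).
rewrite -/(play g S (falling_coefs n.+1) m1) /= -/e -/m1.
move=> /andP[/Ccoco cxy pass].
have := IH m1 erefl pass; rewrite /=.
move: (play _ _ _ _) => m' /le_trans; apply.
rewrite /m1/= mg in cxy *; set y := iterate m - _ in cxy *.
have := averaging_step (iterate m') (e0 n.+1) (erefl y) cxy; apply: le_trans.
rewrite lerD2r; exact: averaging_reweight (e0 _) (e0 _) (falling_coefS _).
Qed.

Lemma gradient_play S cs m : gradient m = g (iterate m) ->
  gradient (play g S cs m) = g (iterate (play g S cs m)).
Proof. by elim: cs m => // c cs IH m _; exact: IH. Qed.

(** The first phase bounds the gap f - f z by its factor 1 / rising_coef ^ 2, the
    second bounds the squared gradient by that gap times 1 / falling_coef ^ 2. *)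
Lemma two_phase_gradient_bound (C : rel 'rV[R]_d) (np : 'rV[R]_d -> R) x0 z n :
  (forall x y, C x y -> coco x y) ->
  (forall s x, dotprod s x <= nq s ^+ 2 / 2 + np x ^+ 2 / 2) ->
  (forall y, f z <= f y) ->
  let kappa := sigma / M in
  let S1 := extrapolation J kappa x0 in
  let S2 := averaging J kappa in
  let m0 := State x0 (g x0) (kappa *: g x0) in
  let m1 := play g S1 (rising_coefs 0 n.+1) m0 in
  let m1' := State (iterate m1) (gradient m1) 0 in
  let m2 := play g S2 (falling_coefs n.+1) m1' in
  passes g C S1 (rising_coefs 0 n.+1) m0 ->
  passes g C S2 (falling_coefs n.+1) m1' ->
  (falling_coef n.+1 * rising_coef n.+1 * nq (gradient m2)) ^+ 2 <=
    (M / sigma * np (x0 - z)) ^+ 2.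
Proof.
move=> Ccoco young zmin kappa S1 S2 m0 m1 m1' m2 pass1 pass2.
have m1g : gradient m1 = g (iterate m1) by exact: gradient_play.
have value_gap : kappa * rising_coef n.+1 ^+ 2 * (f (iterate m1) - f z)
    + nq (dual m1) ^+ 2 / 2 <= dotprod (dual m1) (x0 - z).
  exact: extrapolation_phase Ccoco pass1.
have gradient_gap : nq (gradient m2) ^+ 2 / 2 <=
    M / (sigma * falling_coef n.+1 ^+ 2) * (f (iterate m1) - f (iterate m2)
      + dotprod 0 (iterate m2 - iterate m1)) + nq 0 ^+ 2 / 2.
  exact: (@averaging_phase C n m1').
have := zmin (iterate m2).
have := young (dual m1) (x0 - z).
have n0 : nq 0 ^+ 2 = 0 by rewrite -(scale0r 0) nqZ expr0n mul0r.
move: value_gap gradient_gap; rewrite dotprod0l n0 mul0r !addr0.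
have : 0 < falling_coef n.+1 :> R := lt_le_trans ltr01 (falling_coefS_ge1 n).
have := rising_coef_gt0 (R := R) n.+1.
move: (falling_coef _) (rising_coef _) => e b b0 e0.
move: (nq (gradient m2)) (np _) (dotprod _ _) (nq (dual m1) ^+ 2) => G r dp s.
move: (f z) (f (iterate m1)) (f (iterate m2)) => fz f1 f2 P1 P2 P3 P4.
have gap : kappa * b ^+ 2 * (f1 - fz) <= r ^+ 2 / 2 by lra.
have w0 : 0 < M / (sigma * e ^+ 2) by rewrite divr_gt0 ?mulr_gt0 ?exprn_gt0.
have {}P2 : G ^+ 2 / 2 <= M / (sigma * e ^+ 2) * (f1 - fz).
  by rewrite (le_trans P2)// ler_pM2l// lerD2l lerN2.
have k0 : 0 < (M / sigma) ^+ 2 by rewrite exprn_gt0// divr_gt0.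
move: gap; rewrite -(ler_pM2l k0) => gap.
have eb0 : 0 < (e * b) ^+ 2 by rewrite exprn_gt0// mulr_gt0.
move: P2; rewrite -(ler_pM2l eb0) => P2.
have : (e * b) ^+ 2 * (M / (sigma * e ^+ 2) * (f1 - fz)) =
    (M / sigma) ^+ 2 * (kappa * b ^+ 2 * (f1 - fz)).
  by rewrite /kappa; field; rewrite !gt_eqF.
move=> E; rewrite E in P2; rewrite exprMn [leRHS]exprMn.
move: ((e * b) ^+ 2) ((M / sigma) ^+ 2) (kappa * _ * _) P2 gap => u v w; lra.
Qed.

End MirrorMap.

(** * The routine *)

Section Routine.
Context {R : realType} {d : nat}.
Variables (q M eps : R).
Implicit Types (m : state R d) (S : scheme R d).

(** Follow a scheme, testing each new point against its predecessor, and continue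
    with [k] once all coefficients have been used. *)
Fixpoint guarded S (cs : seq R) m (k : state R d -> routine R d) : routine R d :=
  if cs is c :: cs' then
    let y := next S c m in
    Query y (fun _ gy => Test (iterate m) y (fun b =>
      if b then guarded S cs' (observe S c m gy) k
      else Return (Scale (iterate m) y)))
  else k m.

Definition verdict m : routine R d :=
  Return (if lp_norm q (gradient m) <= eps then Success (iterate m) else Radius).

Variable f : 'rV[R]_d -> R.

(** What a run started after the trajectory [s] has to satisfy. The conclusion of the
    outcome Radius is a parameter [P], and Scale carries no bound on M yet: both
    depend on facts about f that the bookkeeping of queries ignores. *)
Definition sound (P : Prop) (N : nat) (s : seq 'rV[R]_d) (r : routine R d) : Prop :=
  let queries := run_queries q M f r in
  let tests := run_tests q M f r in
  [/\ tests_consecutive q M f r s,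
      match run_outcome q M f r with
      | Success x => x \in s ++ queries /\ lp_norm q (grad f x) <= eps
      | Scale X Y =>
          [/\ (X, Y) \in tests, infix [:: X; Y] (s ++ queries)
            & ~~ cocoercive_at q M f X Y]
      | Radius =>
          [/\ all (fun XY => cocoercive_at q M f XY.1 XY.2) tests,
              eps < lp_norm q (grad f (last 0 (s ++ queries))) & P]
      end
    & (size queries <= N)%N].

(** The continuation may assume that every test of the phase has passed: at the
    first failure the run stops with the failed pair. *)
Lemma guarded_sound P N S cs m s k :
  (passes (grad f) (cocoercive_at q M f) S cs m ->
   forall s', let m' := play (grad f) S cs m in
     sound P N (rcons s' (iterate m')) (k m')) ->
  sound P (size cs + N) (rcons s (iterate m)) (guarded S cs m k).
Proof.
elim: cs m s => [|c cs IH] m s /= H; first exact: H.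
set y := next S c m.
have consecutive : infix [:: iterate m; y] (rcons (rcons s (iterate m)) y).
  by apply/infixP; exists s, [::]; rewrite cats0 -!cats1 -catA.
rewrite /sound/= -/y consecutive/=; move: H; rewrite -/y.
case: ifP => [_|fail] H.
  have [] := IH (observe S c m (grad f y)) (rcons s (iterate m)) (H).
  rewrite /= -/y -cat_rcons.
  set r := guarded _ _ _ _ => cons out size_le; split=> //.
  case: (run_outcome q M f r) out => // X Y [XY inf failXY].
  by split=> //; rewrite inE XY orbT.
split=> //; split; rewrite ?inE ?eqxx ?fail// -cat_rcons cats0//.
Qed.

Lemma sound_verdict P s m : gradient m = grad f (iterate m) ->
  (eps < lp_norm q (gradient m) -> P) ->
  sound P 0 (rcons s (iterate m)) (verdict m).
Proof.
move=> mg HP; rewrite /verdict.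
have [small|large] := lerP (lp_norm q (gradient m)) eps.
  rewrite mg in small; split=> /=; [by []| |by []].
  by split; first by rewrite cats0 mem_rcons mem_head.
have {}HP := HP large; rewrite mg in large.
by split=> /=; [by []| |by []]; rewrite cats0 last_rcons.
Qed.

End Routine.

Section LpGradientBound.
Context {R : realType} {d : nat}.

Lemma lp_gradient_bound (p q sigma M : R) (f : 'rV[R]_d -> R) x0 z n :
  0 < p -> 2 < q -> p^-1 + q^-1 = 1 -> q - 1 = sigma^-1 ->
  0 < sigma -> 0 < M ->
  (forall x, differentiable f x) -> @convex_function R 'rV[R]_d setT f ->
  argmin f z ->
  let g := grad f in
  let kappa := sigma / M in
  let S1 := extrapolation (dual_map q) kappa x0 in
  let S2 := averaging (dual_map q) kappa in
  let m0 := State x0 (g x0) (kappa *: g x0) in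
  let m1 := play g S1 (rising_coefs 0 n.+1) m0 in
  let m1' := State (iterate m1) (gradient m1) 0 in
  let m2 := play g S2 (falling_coefs n.+1) m1' in
  passes g (cocoercive_at q M f) S1 (rising_coefs 0 n.+1) m0 ->
  passes g (cocoercive_at q M f) S2 (falling_coefs n.+1) m1' ->
  falling_coef n.+1 * rising_coef n.+1 * lp_norm q (gradient m2) <=
    M / sigma * lp_norm p (x0 - z).
Proof.
move=> p0 q2 pq q1 sigma0 M0 df cf zmin g kappa S1 S2 m0 m1 m1' m2 pass1 pass2.
have q0 : 0 < q by lra.
have nqZ c (u : 'rV[R]_d) : lp_norm q (c *: u) ^+ 2 = c ^+ 2 * lp_norm q u ^+ 2 :> R.
  by rewrite lp_normZ// exprMn real_normK ?num_real.
have smooth (u v : 'rV[R]_d) : lp_norm q (u + v) ^+ 2 / 2 <= lp_norm q u ^+ 2 / 2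
    + dotprod (dual_map q u) v + lp_norm q v ^+ 2 / (2 * sigma).
  apply: le_trans (lp_norm_sqr_smooth q2 u v) _.
  rewrite q1 lerD2l; move: (lp_norm q v ^+ 2) => nv.
  suff -> : sigma^-1 * nv / 2 = nv / (2 * sigma) by [].
  by field; rewrite gt_eqF.
have young (u v : 'rV[R]_d) : dotprod u v <= lp_norm q u ^+ 2 / 2 + lp_norm p v ^+ 2 / 2.
  have := dotprod_le_lp_norm v u p0 q0 pq; rewrite dotprodC.
  move: (lp_norm q u) (lp_norm p v) (dotprod _ _) => a b c.
  by have := sqr_ge0 (a - b); rewrite sqrrB; lra.
have tangent x y : f x + dotprod (g x) (y - x) <= f y.
  exact: convex_ge_tangent.
have := @two_phase_gradient_bound _ _ _ _ sigma nqZ (dotprod_dual_map q2)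
  (dual_map_convex p0 q2 pq) smooth f g M sigma0 M0 tangent
  (cocoercive_at q M f) (lp_norm p) x0 z n (fun x y => id) young zmin pass1 pass2.
have w0 : 0 <= M / sigma by rewrite divr_ge0 ?ltW.
have eb0 : 0 <= falling_coef n.+1 * rising_coef n.+1 :> R.
  by rewrite mulr_ge0 ?falling_coef_ge0 ?(ltW (rising_coef_gt0 _)).
have lhs0 := mulr_ge0 eb0 (lp_norm_ge0 q (gradient m2)).
have rhs0 := mulr_ge0 w0 (lp_norm_ge0 p (x0 - z)).
move: (_ * _ * lp_norm q _) (_ * lp_norm p _) lhs0 rhs0 => a b a0 b0.
by rewrite ler_pXn2r ?nnegrE.
Qed.

(** The bound on the gradient holds for every minimizer, so the threshold D * (G / eps),
    which exceeds D, is a lower bound for all distances to minimizers, hence for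
    their infimum. *)
Lemma radius_too_small (p sigma M D eps G P : R) (f : 'rV[R]_d -> R) x0 :
  0 < sigma -> 0 < M -> 0 < D -> 0 < eps -> argmin f !=set0 ->
  M * D / (sigma * eps) <= P -> eps < G ->
  (forall z, argmin f z -> P * G <= M / sigma * lp_norm p (x0 - z)) ->
  D < lp_dist p x0 (argmin f).
Proof.
move=> sigma0 M0 D0 eps0 [z0 z0min] leP large bound.
apply: (@lt_le_trans _ _ (D * (G / eps))).
  by rewrite ltr_pMr// ltr_pdivlMr// mul1r.
apply: lb_le_inf; first by exists (lp_norm p (x0 - z0)), z0.
move=> _ [z zmin <-]; have := bound z zmin.
move: (lp_norm p _) => r le_r.
have G0 : 0 <= G by rewrite ltW// (lt_trans eps0).
have {}le_r := le_trans (ler_wpM2r G0 leP) le_r.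
rewrite -(ler_pM2l (divr_gt0 M0 sigma0)); apply: le_trans le_r.
rewrite le_eqVlt; apply/orP; left; apply/eqP.
by field; rewrite !gt_eqF.
Qed.

End LpGradientBound.

Theorem proposition4p1 (R : realType) (p : R) (hp : 1 < p < 2) :
  let q := p / (p - 1) in
  let sigma := p - 1 in
  exists local_routine :
    (* arguments: dimension, eps, x0, M, D, f(x0), grad f(x0) *)
    forall d : nat,
      R -> 'rV[R]_d -> R -> R -> R -> 'rV[R]_d -> routine R d,
  exists C : R, 0 < C /\
  forall (d : nat) (eps : R) (x0 : 'rV[R]_d) (M D : R)
         (f : 'rV[R]_d -> R) (L : R),
    (forall x, differentiable f x) ->
    @convex_function R 'rV[R]_d setT f ->
    argmin f !=set0 ->
    (forall x y, lp_norm q (grad f x - grad f y) <= L * lp_norm p (x - y)) ->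
    0 < eps -> 0 < M -> 0 < D ->
    let G := lp_norm q (grad f x0) in
    eps < G ->
    G / M <= D ->
    let r := local_routine d eps x0 M D (f x0) (grad f x0) in
    let queries := run_queries q M f r in
    let tests := run_tests q M f r in
    let N := (size queries)%:R : R in
    [/\ tests_consecutive q M f r [:: x0],
        match run_outcome q M f r with
        | Success x => x \in x0 :: queries /\ lp_norm q (grad f x) <= eps
        | Scale X Y =>
            [/\ (X, Y) \in tests,
                infix [:: X; Y] (x0 :: queries),
                ~~ cocoercive_at q M f X Y
              & M < L]
        | Radius =>
            [/\ all (fun XY => cocoercive_at q M f XY.1 XY.2) tests,
                eps < lp_norm q (grad f (last x0 queries))
              & D < lp_dist p x0 (argmin f)]
        end,
        N <= 4 * Num.sqrt (M * D / (sigma * eps)) + 2,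
        4 * Num.sqrt (M * D / (sigma * eps)) + 2
          <= (4 / Num.sqrt sigma + 2) * Num.sqrt (M * D / eps)
      & N <= C * Num.sqrt (M * D / eps)].
Proof.
move=> q sigma; have /andP[p1 p2] := hp.
have p0 : 0 < p by lra.
have sigma0 : 0 < sigma by rewrite subr_gt0.
have q2 : 2 < q by rewrite /q ltr_pdivlMr// -/sigma /sigma; lra.
have q0 : 0 < q by lra.
have pq : p^-1 + q^-1 = 1 by rewrite /q; field; rewrite !gt_eqF.
have q1 : q - 1 = sigma^-1 by rewrite /q /sigma; field; rewrite gt_eqF.
clearbody q.
(* Both phases have floor (2 K) + 1 steps with K = sqrt (M D / (sigma eps)), the
   least number n with n > 2 K, so that n ^ 2 / 4 exceeds K ^ 2. *)
exists (fun d eps x0 M D _ g0 =>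
  let kappa := sigma / M in
  let n := Num.truncn (2 * Num.sqrt (M * D / (sigma * eps))) in
  guarded (extrapolation (dual_map q) kappa x0) (rising_coefs 0 n.+1)
    (State x0 g0 (kappa *: g0)) (fun m =>
  guarded (averaging (dual_map q) kappa) (falling_coefs n.+1)
    (State (iterate m) (gradient m) 0) (fun m' =>
  verdict q eps m'))).
exists (4 / Num.sqrt sigma + 2); split.
  by rewrite addr_gt0// divr_gt0// sqrtr_gt0.
move=> d eps x0 M D f L df cf argmin0 Lip eps0 M0 D0 G epsG GMD.
set kappa := sigma / M.
set K := Num.sqrt (M * D / (sigma * eps)).
set n := Num.truncn (2 * K).
set S1 := extrapolation (dual_map q) kappa x0.
set S2 := averaging (dual_map (d := d) q) kappa.
move=> r queries tests N.
have K0 : 0 <= K by exact: sqrtr_ge0.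
have KE : K ^+ 2 = M * D / (sigma * eps).
  by rewrite sqr_sqrtr// divr_ge0 ?mulr_ge0 ?ltW.
have : sound q M eps f (D < lp_dist p x0 (argmin f))
    (size (rising_coefs 0 n.+1 : seq R) + (size (falling_coefs n.+1 : seq R) + 0))
    [:: x0] r.
  apply: (@guarded_sound _ _ _ _ _ _ _ _ S1 _ (State x0 (grad f x0) _) [::]).
  set m0 := State _ _ _ => pass1 s1 m1.
  apply: (@guarded_sound _ _ _ _ _ _ _ _ S2 _ (State _ _ _) s1).
  set m1' := State _ _ _ => pass2 s2 m2.
  have m2g : gradient m2 = grad f (iterate m2).
    by do 2! apply: gradient_play.
  have bound z : argmin f z -> falling_coef n.+1 * rising_coef n.+1
      * lp_norm q (gradient m2) <= M / sigma * lp_norm p (x0 - z).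
    move=> zmin; exact: (lp_gradient_bound p0 q2 pq q1 sigma0 M0 df cf zmin pass1 pass2).
  apply: (@sound_verdict _ _ q M eps f _ s2 m2 m2g) => large.
  apply: (radius_too_small sigma0 M0 D0 eps0 argmin0 _ large bound).
  rewrite -KE; apply: le_trans (sqr_le_coef_product n.+1).
  have n2K : 2 * K <= n.+1%:R by rewrite ltW// truncnS_gt.
  rewrite ler_pdivlMr// (_ : K ^+ 2 * 4 = (2 * K) ^+ 2); last by ring.
  by rewrite ler_pXn2r ?nnegrE ?mulr_ge0.
rewrite size_rising_coefs size_falling_coefs.
case; rewrite -/r -/queries -/tests => cons out size_le.
have N_le : N <= 4 * K + 2.
  have : (size queries)%:R <= (n.+1 + (n.+1 + 0))%:R :> R by rewrite ler_nat.
  have : n%:R <= 2 * K by rewrite truncn_le mulr_ge0.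
  by rewrite /N addn0 natrD -natr1; lra.
have budget : 4 * K + 2 <= (4 / Num.sqrt sigma + 2) * Num.sqrt (M * D / eps).
  have -> : K = Num.sqrt (M * D / eps) / Num.sqrt sigma.
    rewrite -sqrtrV ?ltW// -sqrtrM ?divr_ge0 ?mulr_ge0 ?ltW//.
    by congr Num.sqrt; rewrite invfM mulrA mulrAC.
  have : 1 <= Num.sqrt (M * D / eps).
    rewrite -[leLHS]sqrtr1 ler_wsqrtr// ler_pdivlMr// mul1r.
    rewrite ler_pdivrMr// in GMD; rewrite mulrC.
    exact: le_trans (ltW epsG) GMD.
  move: (Num.sqrt (M * D / eps)) => t t1.
  rewrite (_ : (4 / _ + 2) * t = 4 * (t / Num.sqrt sigma) + 2 * t); last by ring.
  lra.
split=> //; last exact: le_trans budget.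
case: (run_outcome q M f r) out => // X Y [XY inf failXY]; split=> //.
rewrite ltNge; apply: contra failXY => LM.
exact: smooth_convex_cocoercive Lip.
Qed.
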